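(* Let $U\subseteq\mathbb{R}^d$ be open and convex. For every convex function $f:U\to\mathbb{R}$ and every $\varepsilon>0$ there exists a real-analytic convex function $g:U\to\mathbb{R}$ such that $f-\varepsilon\leq g\leq f$ on $U$. *)

(* Defs.v *)
From HB Require Import structures.
From mathcomp Require Import all_boot all_order all_algebra finmap.
From mathcomp Require Import all_classical all_reals all_analysis.
From mathcomp Require Import showcase.summability.
Set Implicit Arguments.
Unset Strict Implicit.
Unset Printing Implicit Defensive.

Import Order.TTheory GRing.Theory Num.Theory.
Import numFieldNormedType.Exports.

Local Open Scope classical_set_scope.
Local Open Scope ring_scope.

Definition monomial (R : realType) (d : nat) (k : {ffun 'I_d -> nat})
    (v : 'rV[R]_d) : R :=
  \prod_(i < d) v ord0 i ^+ k i.

(* Near x, g is the sum of a power series in y - x.  The series is indexed by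
   multi-indices and its convergence is unconditional: the limit is taken along
   the finite sets of multi-indices directed by inclusion. *)
Definition real_analytic_at (R : realType) (d : nat) (g : 'rV[R]_d -> R)
    (x : 'rV[R]_d) : Prop :=
  exists c : {ffun 'I_d -> nat} -> R,
    \forall y \near x,
      partial_sum (fun k => c k * monomial k (y - x) : R^o) A @[A --> totally]
        --> g y.

Definition real_analytic_on (R : realType) (d : nat) (U : set 'rV[R]_d)
    (g : 'rV[R]_d -> R) : Prop :=
  forall x, U x -> real_analytic_at g x.

(* Main.v *)
Require Import Defs.
From HB Require Import structures.
From mathcomp Require Import all_boot all_order all_algebra finmap.
From mathcomp Require Import all_classical all_reals all_analysis.
From mathcomp Require Import showcase.summability ring lra.
Set Implicit Arguments.
Unset Strict Implicit.
Unset Printing Implicit Defensive.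

Import Order.TTheory GRing.Theory Num.Theory.
Import numFieldNormedType.Exports.

(** The approximation [g] is a soft maximum of countably many affine minorants of
    [f], formed so that it stays analytic.

    A convex [f] on an open convex [U] is the supremum of its tangent functions,
    and on each set of a compact exhaustion of [U] finitely many of them come
    within any prescribed [eps_n = e / 2 ^ n.+1] of [f]
    ([affine_minorants]).  This gives finite lists [s_0, s_1, ...] of affine
    functions below [f] such that every point of [U] has, for some [n], an [a] in
    [s_n] with [f - a < eps_n] there.  Lower the functions of [s_n] by
    [c_n = e - eps_n], which increases to [e], and absorb the lists one after the
    other, starting from one minorant lowered by [c_0], into
      [h_(n+1) = l_n^-1 * ln (exp (l_n h_n) + \sum_(a <- s_n) exp (l_n (a - c_n)))].
    A logarithm of a sum of exponentials of convex functions is convex, and it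
    exceeds the maximum by at most [ln (1 + size s_n) / l_n]; so [h_n] increases to
    a convex [g], with [g <= f] once the rates [l_n] are large, and [g >= f - e]
    because [a - c_n > f - e] at a point where [f - a < eps_n].

    Analyticity of [g] is where the increasing offsets matter.  At a point [x] of
    [U] some stage [h_K] already exceeds [f x - e] by a margin [4 * D], while all
    later entries [a - c_n] are at most [f - e + eps_n].  Near [x] they therefore
    lie below [h_n] by a margin that does not depend on [n], and the increment
    [h_(n+1) - h_n = l_n^-1 * ln (1 + w)] has [w] at most 1/2, so that dividing by
    [l_n] makes the increments summable.  The estimate must hold for power series
    and not only on real points: [majorized r M h] says that [h] is a power series in
    the polydisc of radius [r] with weighted l1 norm at most [M], a norm that is
    submultiplicative and passes to infinite sums, hence to [exp] and to
    [ln (1 + _)].  For an affine function [a], the norm of [exp (l * a)] is at most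
    [exp (l * m)], with [m] the maximum of [a] over the polydisc; as [a <= f], [m] is
    at most the supremum of [f] there, which upper semicontinuity keeps close to
    [f x] however steep [a] is.  So the increments are summable in this norm on one
    fixed polydisc ([majorized_increment], [soft_sup_majorized]). *)

Local Open Scope classical_set_scope.
Local Open Scope ring_scope.

(** * Unconditional sums of real families *)

Section unconditional_sums.
Variable R : realType.

(** Convergence along the finite subsets ordered by inclusion, spelled out with
    [e] because every argument below compares finite sums. *)
Definition has_sum (I : choiceType) (F : I -> R) (s : R) :=
  forall e, 0 < e -> exists A : {fset I}, forall B : {fset I},
    (A `<=` B)%fset -> `|\sum_(i <- B) F i - s| <= e.

Definition sums_le (I : choiceType) (F : I -> R) (M : R) :=
  forall A : {fset I}, \sum_(i <- A) F i <= M.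

Lemma ler_sum_subset (I : eqType) (s t : seq I) (F : I -> R) :
  uniq s -> uniq t -> {subset s <= t} -> (forall i, 0 <= F i) ->
  \sum_(i <- s) F i <= \sum_(i <- t) F i.
Proof.
move=> us ut st F0; rewrite [leRHS](bigID (mem s))/= -[leLHS]addr0.
rewrite lerD ?sumr_ge0// le_eqVlt; apply/orP; left; apply/eqP.
rewrite -[RHS]big_filter; apply: perm_big; apply: uniq_perm => //.
  by rewrite filter_uniq.
by move=> i; rewrite mem_filter; case: (boolP (i \in s)) => // /st ->.
Qed.

Lemma ler_sum_fsubset (I : choiceType) (A B : {fset I}) (F : I -> R) :
  (A `<=` B)%fset -> (forall i, 0 <= F i) ->
  \sum_(i <- A) F i <= \sum_(i <- B) F i.
Proof. by move=> /fsubsetP AB; apply: ler_sum_subset => //; exact: fset_uniq. Qed.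

Lemma sums_le_ge0 (I : choiceType) (F : I -> R) M : sums_le F M -> 0 <= M.
Proof. by move=> /(_ fset0); rewrite big_seq_fset0. Qed.

Lemma has_sumD (I : choiceType) (F G : I -> R) s t :
  has_sum F s -> has_sum G t -> has_sum (fun i => F i + G i) (s + t).
Proof.
move=> Fs Gt e e0; have e20 : 0 < e / 2 by lra.
have [A HA] := Fs _ e20; have [B HB] := Gt _ e20.
exists (A `|` B)%fset => C; rewrite fsubUset => /andP[AC BC].
rewrite big_split/= opprD addrACA (splitr e).
by rewrite (le_trans (ler_normD _ _))// lerD ?HA ?HB.
Qed.

Lemma has_sum0 (I : choiceType) : has_sum (fun _ : I => 0) 0.
Proof. by move=> e e0; exists fset0 => B _; rewrite big1// subr0 normr0 ltW. Qed.

Lemma has_sum_big (I : choiceType) (J : eqType) (r : seq J) (F : J -> I -> R) s :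
  (forall j, has_sum (F j) (s j)) ->
  has_sum (fun i => \sum_(j <- r) F j i) (\sum_(j <- r) s j).
Proof.
move=> Fs; elim: r => [|j r IH].
  rewrite big_nil (_ : (fun _ => _) = (fun _ => 0)); first exact: has_sum0.
  by apply/funext => i; rewrite big_nil.
rewrite big_cons (_ : (fun _ => _) = (fun i => F j i + \sum_(j <- r) F j i)).
  exact: has_sumD.
by apply/funext => i; rewrite big_cons.
Qed.

Lemma has_sumZ (I : choiceType) a (F : I -> R) s :
  has_sum F s -> has_sum (fun i => a * F i) (a * s).
Proof.
move=> Fs e e0; have a0 : 0 < `|a| + 1 by rewrite ltr_wpDl.
have [A HA] := Fs _ (divr_gt0 e0 a0).
exists A => B /HA H; rewrite -mulr_sumr -mulrBr normrM.
rewrite (le_trans (ler_wpM2l (normr_ge0 a) H))// mulrCA ger_pMr//.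
by rewrite ler_pdivrMr// mul1r lerDl.
Qed.

Lemma has_sum_single (I : choiceType) (i0 : I) a :
  has_sum (fun i => if i == i0 then a else 0) a.
Proof.
move=> e e0; exists [fset i0]%fset => B; rewrite fsub1set => i0B.
rewrite (big_fsetD1 i0)//= eqxx big_seq big1 ?addr0 ?subrr ?normr0 ?ltW// => i.
by rewrite !inE => /andP[/negbTE ->].
Qed.

Lemma has_sum_uniq (I : choiceType) (F : I -> R) s t :
  has_sum F s -> has_sum F t -> s = t.
Proof.
move=> Fs Ft; apply/eqP; rewrite -subr_eq0 -normr_le0; apply/ler_addgt0Pr => e e0.
have e20 : 0 < e / 2 by lra.
have [A HA] := Fs _ e20; have [B HB] := Ft _ e20.
have {}HA := HA _ (fsubsetUl A B); have {}HB := HB _ (fsubsetUr A B).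
rewrite add0r (splitr e).
set S := \sum_(i <- _) _ in HA HB.
rewrite (_ : s - t = (S - t) - (S - s)); last by ring.
by rewrite (le_trans (ler_normB _ _))// lerD.
Qed.

Lemma has_sum_le (I : choiceType) (F : I -> R) s M :
  has_sum F s -> sums_le F M -> s <= M.
Proof.
move=> Fs FM; apply/ler_addgt0Pr => e e0; have [A HA] := Fs _ e0.
have := HA _ (fsubset_refl A); have := FM A; rewrite ler_norml => ? /andP[]; lra.
Qed.

Lemma has_sumN (I : choiceType) (F : I -> R) s :
  has_sum F s -> has_sum (fun i => - F i) (- s).
Proof.
move=> /(has_sumZ (-1)); rewrite mulN1r; congr (has_sum _ _).
by apply/funext => i; rewrite mulN1r.
Qed.

Lemma has_sum_norm_le (I : choiceType) (F : I -> R) s M :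
  has_sum F s -> sums_le (fun i => `|F i|) M -> `|s| <= M.
Proof.
move=> Fs FM; rewrite ler_norml lerNl.
apply/andP; split; [apply: has_sum_le (has_sumN Fs) _|apply: has_sum_le Fs _].
  by move=> A; apply: le_trans (FM A); apply: ler_sum => i _; rewrite -normrN ler_norm.
by move=> A; apply: le_trans (FM A); apply: ler_sum => i _; rewrite ler_norm.
Qed.

Lemma nonneg_has_sum (I : choiceType) (F : I -> R) M :
  (forall i, 0 <= F i) -> sums_le F M -> exists s, has_sum F s.
Proof.
move=> F0 FM; pose S := [set \sum_(i <- A) F i | A in [set: {fset I}]].
have hS : has_sup S.
  split; first by exists (\sum_(i <- fset0) F i), fset0.
  by exists M => _ [A _ <-].
exists (sup S) => e e0; have [_ [A _ <-] HA] := sup_adherent e0 hS.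
exists A => B AB; rewrite ler_norml; apply/andP; split.
  by have := ler_sum_fsubset AB F0; lra.
have : \sum_(i <- B) F i <= sup S by apply: (sup_ubound hS.2); exists B.
lra.
Qed.

(** [F] is the difference of the nonnegative families [`|F|] and [`|F| - F]. *)
Lemma abs_has_sum (I : choiceType) (F : I -> R) M :
  sums_le (fun i => `|F i|) M -> exists s, has_sum F s.
Proof.
move=> FM; have [s Hs] := nonneg_has_sum (fun i => normr_ge0 (F i)) FM.
have [|A|t Ht] := @nonneg_has_sum I (fun i => `|F i| - F i) (M + M).
- by move=> i; rewrite subr_ge0 ler_norm.
- rewrite big_split/= lerD//; apply: le_trans (FM A).
  by apply: ler_sum => i _; rewrite -normrN ler_norm.
exists (s - t); have := has_sumD Hs (has_sumN Ht); congr (has_sum _ _).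
by apply/funext => i; ring.
Qed.

(** Past a large finite rectangle the absolutely convergent double sum hardly moves,
    so both iterated sums are close to the sum over that rectangle. *)
Lemma has_sum_exchange (I J : choiceType) (F : I -> J -> R) M u w s :
  (forall A B, \sum_(i <- A : {fset I}) \sum_(j <- B : {fset J}) `|F i j| <= M) ->
  (forall i, has_sum (F i) (u i)) -> (forall j, has_sum (F^~ j) (w j)) ->
  has_sum u s -> has_sum w s.
Proof.
move=> FM Fu Fw us e e0.
pose Phi (G : I -> J -> R) (A : {fset I}) (B : {fset J}) :=
  \sum_(i <- A) \sum_(j <- B) G i j.
have Phi_mono G A A' B B' : (forall i j, 0 <= G i j) ->
    (A `<=` A')%fset -> (B `<=` B')%fset -> Phi G A B <= Phi G A' B'.
  move=> G0 AA BB; apply: (@le_trans _ _ (Phi G A B')).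
    by apply: ler_sum => i _; exact: ler_sum_fsubset.
  by apply: ler_sum_fsubset => // i; exact: sumr_ge0.
pose N i j := `|F i j|.
pose S := [set Phi N AB.1 AB.2 | AB in [set: {fset I} * {fset J}]].
have hS : has_sup S.
  split; first by exists (Phi N fset0 fset0), (fset0, fset0).
  by exists M => _ [[A B] _ <-]; exact: FM.
have e30 : 0 < e / 3 by lra.
have [_ [[A0 B0] _ <-] /= H0] := sup_adherent e30 hS.
have close A B : (A0 `<=` A)%fset -> (B0 `<=` B)%fset ->
    `|Phi F A B - Phi F A0 B0| <= e / 3.
  move=> AA BB.
  have le_sup : Phi N A B <= sup S by apply: (sup_ubound hS.2); exists (A, B).
  have mono G : (forall i j, 0 <= G i j) -> Phi G A0 B0 <= Phi G A B.
    by move=> G0; exact: Phi_mono.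
  have PhiD G H C D : Phi (fun i j => G i j + H i j) C D = Phi G C D + Phi H C D.
    by rewrite /Phi -big_split/=; apply: eq_bigr => i _; rewrite big_split.
  have PhiN G C D : Phi (fun i j => - G i j) C D = - Phi G C D.
    by rewrite /Phi -sumrN; apply: eq_bigr => i _; rewrite sumrN.
  have := mono (fun i j => N i j + F i j).
  rewrite !PhiD => /(_ _)/wrap[].
    by move=> i j; rewrite /N; have := ler_norm (- F i j); rewrite normrN; lra.
  have := mono (fun i j => N i j + - F i j).
  rewrite !PhiD !PhiN => /(_ _)/wrap[].
    by move=> i j; rewrite /N; have := ler_norm (F i j); lra.
  by rewrite ler_norml => ? ?; apply/andP; split; lra.
have limrow A : (A0 `<=` A)%fset -> `|\sum_(i <- A) u i - Phi F A0 B0| <= e / 3.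
  move=> AA; apply/ler_addgt0Pr => h h0.
  have [B HB] := has_sum_big A Fu h0.
  have := HB _ (fsubsetUr B0 B); have := close _ _ AA (fsubsetUl B0 B).
  rewrite /Phi [in X in X -> _]exchange_big/= !ler_norml => /andP[? ?] /andP[? ?].
  by apply/andP; split; lra.
have limcol B : (B0 `<=` B)%fset -> `|\sum_(j <- B) w j - Phi F A0 B0| <= e / 3.
  move=> BB; apply/ler_addgt0Pr => h h0.
  have [A HA] := has_sum_big B Fw h0.
  have := HA _ (fsubsetUr A0 A); have := close _ _ (fsubsetUl A0 A) BB.
  rewrite /Phi !ler_norml => /andP[? ?] /andP[? ?].
  by apply/andP; split; lra.
have [A HA] := us _ e30.
exists B0 => B /limcol; have := HA _ (fsubsetUr A0 A); have := limrow _ (fsubsetUl A0 A).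
by rewrite !ler_norml => /andP[? ?] /andP[? ?] /andP[? ?]; apply/andP; split; lra.
Qed.

Lemma sums_le_nat (F : nat -> R) M : (forall n, 0 <= F n) ->
  (forall n, series F n <= M) -> sums_le F M.
Proof.
move=> F0 FM A; have [N HN] : exists N, {subset A <= index_iota 0 N}.
  exists (\max_(i <- A) i).+1 => i iA; rewrite mem_index_iota/= ltnS.
  exact: leq_bigmax_seq.
apply: le_trans (FM N); apply: ler_sum_subset => //;
by rewrite iota_uniq.
Qed.

(** The unconditional sum exists by absolute convergence, and the initial segments
    are cofinal among the finite sets. *)
Lemma has_sum_nat (F : nat -> R) M s : sums_le (fun n => `|F n|) M ->
  series F @ \oo --> s -> has_sum F s.
Proof.
move=> FM Fs; have [t Ft] := abs_has_sum FM.
suff -> : s = t by [].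
apply: (cvg_unique (@Rhausdorff R) Fs).
apply/cvgrPdist_le => e e0; have [A HA] := Ft _ e0.
exists (\max_(i <- A) i).+1 => // n /= An.
have := HA [fset i | i in index_iota 0 n]%fset.
rewrite distrC /series/= big_imfset//= => /(_ _)/wrap[|].
  apply/fsubsetP => i iA; apply/imfsetP; exists i => //=.
  rewrite mem_index_iota/=; apply: leq_trans An; rewrite ltnS.
  exact: leq_bigmax_seq.
by rewrite undup_id ?iota_uniq.
Qed.

End unconditional_sums.

(** * The Mercator series *)

Section mercator.
Variable R : realType.
Implicit Types x y : R.

Definition mercator x n : R := (-1) ^+ n * x ^+ n.+1 / n.+1%:R.

Lemma is_derive_mercator N x :
  is_derive x 1 (fun y => series (mercator y) N) (\sum_(n < N) (- x) ^+ n).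
Proof.
elim: N => [|N IH].
  rewrite big_ord0 (_ : (fun _ => _) = cst 0); first exact: is_derive_cst.
  by apply/funext => y; rewrite /series/= big_geq.
rewrite big_ord_recr/=.
rewrite (_ : (fun y => _) = (fun y => series (mercator y) N) +
    (((-1) ^+ N / N.+1%:R) \*: ((id : R -> R) ^+ N.+1))); last first.
  apply/funext => y; rewrite /series/= big_nat_recr//=; congr (_ + _).
  by rewrite /mercator /GRing.scale/= exprfctE mulrAC.
apply: is_deriveD.
apply: (is_derive_eq (is_deriveZ _ (is_deriveX _ (is_derive_id _ _)))).
rewrite /GRing.scale/= mulr1 [RHS]exprNn mulrA divfK//.
Qed.

(** The remainder after [N] terms has derivative [(- y) ^+ N / (1 + y)], so the mean
    value theorem bounds it by [2^-1 ^+ N]. *)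
Lemma cvg_mercator x : `|x| <= 2^-1 -> series (mercator x) @ \oo --> ln (1 + x).
Proof.
move=> hx.
have bound N : `|ln (1 + x) - series (mercator x) N| <= 2^-1 ^+ N.
  pose F y := ln (1 + y) - series (mercator y) N.
  have dF y : `|y| <= 2^-1 -> is_derive y 1 F ((- y) ^+ N / (1 + y)).
    rewrite ler_norml => /andP[y1 y2]; have y0 : 0 < 1 + y by lra.
    have dln : is_derive y 1 (fun y => ln (1 + y)) (1 + y)^-1.
      have dln := is_derive1_ln y0.
      have d1 : is_derive y 1 (fun y => 1 + y) (1 : R).
        have := is_deriveD (is_derive_cst (1 : R) y (1 : R)) (is_derive_id y (1 : R)).
        by rewrite add0r.
      by have := is_derive1_comp dln d1; rewrite mulr1.
    apply: (is_derive_eq (is_deriveB dln (is_derive_mercator N y))).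
    have geo := subrX1 (- y) N.
    apply: (mulIf (lt0r_neq0 y0)); rewrite divfK ?lt0r_neq0// mulrBl mulVf ?lt0r_neq0//.
    by rewrite -[RHS](subrK 1) geo; ring.
  have F0 : F 0 = 0.
    rewrite /F addr0 ln1 sub0r /series/= big1 ?oppr0// => n _.
    by rewrite /mercator expr0n/= mulr0 mul0r.
  have cF a b : `|a| <= 2^-1 -> `|b| <= 2^-1 -> {within `[a, b], continuous F}.
    rewrite !ler_norml => /andP[a1 a2] /andP[b1 b2].
    apply: derivable_within_continuous => y; rewrite in_itv/= => /andP[ay yb].
    apply: ex_derive; apply: dF; rewrite ler_norml; apply/andP; split; lra.
  have [c [hc Fx]] : exists c, `|c| <= `|x| /\ F x = (- c) ^+ N / (1 + c) * x.
    have h0 : `|0 : R| <= 2^-1 by rewrite normr0 invr_ge0.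
    have [x0|x0] := leP 0 x.
      have [||c] := @MVT_segment _ F (fun y => (- y) ^+ N / (1 + y)) 0 x x0.
      - move=> y; rewrite in_itv/= => /andP[y0 yx]; apply: dF.
        by move: hx; rewrite !ger0_norm//; lra.
      - exact: cF.
      rewrite in_itv/= F0 !subr0 => /andP[c0 cx] ->; exists c; split => //.
      by rewrite !ger0_norm.
    have [||c] := @MVT_segment _ F (fun y => (- y) ^+ N / (1 + y)) x 0 (ltW x0).
    - move=> y; rewrite in_itv/= => /andP[y0 yx]; apply: dF.
      by move: hx; rewrite !ltr0_norm//; lra.
    - exact: cF.
    rewrite in_itv/= F0 sub0r => /andP[xc c0] E; exists c; split.
      by rewrite !ler0_norm//; lra.
    by apply: oppr_inj; rewrite E; ring.
  have hc2 := le_trans hc hx; move: (hc2); rewrite ler_norml => /andP[c1 c2].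
  have c0 : 0 < 1 + c by lra.
  rewrite -/(F x) Fx !normrM normrX normrN normfV (gtr0_norm c0).
  have cN : `|c| ^+ N <= 2^-1 ^+ N by rewrite lerXn2r// nnegrE ?invr_ge0.
  rewrite -[leRHS]mulr1 -mulrA; apply: ler_pM => //.
    by rewrite mulr_ge0// invr_ge0 ltW.
  by rewrite mulrC ler_pdivrMr// mul1r; lra.
apply/cvgrPdist_le => e e0.
have half1 : `|2^-1 : R| < 1 by rewrite ger0_norm ?invr_ge0//; lra.
have /cvgrPdist_le /(_ _ e0) := cvg_expr half1.
apply: filterS => n; rewrite sub0r normrN ger0_norm ?exprn_ge0 ?invr_ge0//.
exact: le_trans.
Qed.

End mercator.

(** * Functions majorized by a power series *)

Section majorized.
Variables (R : realType) (d : nat).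
Local Notation V := 'rV[R]_d.
Local Notation mindex := {ffun 'I_d -> nat}.
Implicit Types (r M : R) (g h : V -> R) (m k : mindex) (v : V).

Definition weight r k : R := monomial k (const_mx r : V).

Definition polydisc r v := forall i, `|v ord0 i| <= r.

(** The weighted l1 norm of the coefficients bounds the modulus of the complex
    extension of [g] to the polydisc, and replaces it in all estimates. *)
Definition majorized r M g := exists c : mindex -> R,
  sums_le (fun k => `|c k| * weight r k) M /\
  forall v, polydisc r v -> has_sum (fun k => c k * monomial k v) (g v).

Lemma monomialD m k v :
  monomial [ffun i => (m i + k i)%N] v = monomial m v * monomial k v.
Proof. by rewrite /monomial -big_split/=; apply: eq_bigr => i _; rewrite ffunE exprD. Qed.

Lemma monomial0 v : monomial [ffun=> 0%N] v = 1.
Proof. by rewrite /monomial big1// => i _; rewrite ffunE. Qed.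

Lemma weight_gt0 r k : 0 < r -> 0 < weight r k.
Proof. by move=> r0; apply: prodr_gt0 => i _; rewrite mxE exprn_gt0. Qed.

Lemma normr_monomial_le r k v : polydisc r v -> `|monomial k v| <= weight r k.
Proof.
move=> rv; rewrite /monomial normr_prod; apply: ler_prod => i _.
by rewrite normr_ge0/= mxE normrX lerXn2r// nnegrE// (le_trans _ (rv i)).
Qed.

Lemma majorized_ge0 r M g : majorized r M g -> 0 <= M.
Proof. by case=> c [/sums_le_ge0]. Qed.

Lemma majorized_le r M N g : M <= N -> majorized r M g -> majorized r N g.
Proof. by move=> MN [c [cM cg]]; exists c; split=> // A; exact: le_trans (cM A) _. Qed.

Lemma majorized_ext r M g h : (forall v, polydisc r v -> g v = h v) ->
  majorized r M g -> majorized r M h.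
Proof. by move=> gh [c [cM cg]]; exists c; split=> // v rv; rewrite -gh//; exact: cg. Qed.

Lemma majorized_shrink r q M g : 0 <= q -> q <= r ->
  majorized r M g -> majorized q M g.
Proof.
move=> q0 qr [c [cM cg]]; exists c; split.
  move=> A; apply: le_trans (cM A); apply: ler_sum => k _; rewrite ler_wpM2l//.
  by apply: ler_prod => i _; rewrite !mxE exprn_ge0//= lerXn2r// nnegrE// (le_trans q0).
by move=> v qv; apply: cg => i; exact: le_trans (qv i) qr.
Qed.

Lemma majorized_norm_le r M g v : majorized r M g -> polydisc r v -> `|g v| <= M.
Proof.
move=> [c [cM cg]] rv; apply: (has_sum_norm_le (cg v rv)) => A.
apply: le_trans (cM A); apply: ler_sum => k _; rewrite normrM ler_wpM2l//.
exact: normr_monomial_le.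
Qed.

Lemma majorized_monomial r a m : 0 < r ->
  majorized r (`|a| * weight r m) (fun v => a * monomial m v).
Proof.
move=> r0; exists (fun k => if k == m then a else 0); split=> [A|v _].
  have [mA|mA] := boolP (m \in A).
    rewrite (big_fsetD1 m)//= eqxx big_seq big1 ?addr0// => k.
    by rewrite !inE => /andP[/negbTE -> _]; rewrite normr0 mul0r.
  rewrite big_seq big1 ?mulr_ge0 ?(ltW (weight_gt0 _ _))// => k kA.
  by case: eqP => [km|]; [move: mA; rewrite -km kA|rewrite normr0 mul0r].
have := has_sum_single m (a * monomial m v); congr (has_sum _ _).
by apply/funext => k; case: eqP => [->//|]; rewrite mul0r.
Qed.

(** Each coefficient of the sum is the sum of the coefficients; the value at [v] is
    then recovered by exchanging the two summations. *)
Lemma majorized_sum (I : choiceType) (g : I -> V -> R) (N : I -> R) r M h :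
  0 < r -> (forall i, majorized r (N i) (g i)) -> sums_le N M ->
  (forall v, polydisc r v -> has_sum (g^~ v) (h v)) -> majorized r M h.
Proof.
move=> r0 /choice[c /all_and2[cN cg]] NM gh.
have rect A B :
    \sum_(i <- A : {fset I}) \sum_(k <- B : {fset mindex}) `|c i k| * weight r k <= M.
  by apply: le_trans (NM A); apply: ler_sum => i _; exact: cN.
have /choice[C HC] k : exists s, has_sum (c^~ k) s.
  apply: (@abs_has_sum _ _ _ (M / weight r k)) => A.
  rewrite ler_pdivlMr ?weight_gt0// mulr_suml; apply: le_trans (rect A [fset k]%fset).
  by apply: ler_sum => i _; rewrite big_seq_fset1.
exists C; split=> [B|v rv].
  (* [`|C k|] is itself a sum over [i], of the terms [sg (C k) * c i k]. *)
  have := has_sum_big B (fun k => has_sumZ (Num.sg (C k) * weight r k) (HC k)).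
  move=> /has_sum_le H.
  rewrite (eq_bigr (fun k => Num.sg (C k) * weight r k * C k)).
    apply: H => A; apply: le_trans (rect A B); apply: ler_sum => i _.
    apply: ler_sum => k _; apply: le_trans (ler_norm _) _.
    rewrite !normrM (gtr0_norm (weight_gt0 k r0)) mulrC ler_wpM2l// normr_sg.
    by rewrite ler_piMl ?lern1 ?leq_b1// ltW// weight_gt0.
  by move=> k _; rewrite mulrAC -normrEsg.
apply: (@has_sum_exchange _ _ _ (fun i k => c i k * monomial k v) M (g^~ v)).
- move=> A B; apply: le_trans (rect A B); apply: ler_sum => i _; apply: ler_sum => k _.
  by rewrite normrM ler_wpM2l// normr_monomial_le.
- by move=> i; exact: cg.
- move=> k; rewrite mulrC; have := has_sumZ (monomial k v) (HC k); congr (has_sum _ _).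
  by apply/funext => i; rewrite mulrC.
- exact: gh.
Qed.

(** A monomial times a series is a sum of monomials, and a product of two series is
    a sum of monomials times the second one: [majorized_sum] is applied twice, and
    no Cauchy product is formed. *)
Lemma majorizedM r M N g h : 0 < r ->
  majorized r M g -> majorized r N h -> majorized r (M * N) (fun v => g v * h v).
Proof.
move=> r0 [b [bM bg]] hN.
have N0 := majorized_ge0 hN.
have mono a m : majorized r (`|a| * weight r m * N) (fun v => a * monomial m v * h v).
  case: hN => c [cN ch].
  apply: (majorized_sum (I := mindex)
      (g := fun k v => a * c k * monomial [ffun i => (m i + k i)%N] v) r0) => [k||v rv].
  - exact: majorized_monomial.
  - move=> A; rewrite (eq_bigr (fun k => `|a| * weight r m * (`|c k| * weight r k))).
      rewrite -mulr_sumr ler_wpM2l// mulr_ge0// ltW// weight_gt0//.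
    by move=> k _; rewrite normrM /weight monomialD; ring.
  - have := has_sumZ (a * monomial m v) (ch v rv); congr (has_sum _ _).
    by apply/funext => k; rewrite monomialD; ring.
apply: (majorized_sum (I := mindex)
    (g := fun k v => b k * monomial k v * h v) r0 (fun k => mono (b k) k)) => [A|v rv].
  by rewrite -mulr_suml ler_wpM2r.
rewrite mulrC; have := has_sumZ (h v) (bg v rv); congr (has_sum _ _).
by apply/funext => k; rewrite mulrC.
Qed.

Lemma majorizedD r M N g h : 0 < r ->
  majorized r M g -> majorized r N h -> majorized r (M + N) (fun v => g v + h v).
Proof.
move=> r0 [b [bM bg]] [c [cN ch]]; exists (fun k => b k + c k); split=> [A|v rv].
  apply: le_trans (lerD (bM A) (cN A)); rewrite -big_split/=; apply: ler_sum => k _.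
  by rewrite -mulrDl ler_wpM2r ?ler_normD// ltW// weight_gt0.
have := has_sumD (bg v rv) (ch v rv); congr (has_sum _ _).
by apply/funext => k; rewrite mulrDl.
Qed.

Lemma majorized_cst r a (r_gt0 : 0 < r) : majorized r `|a| (fun=> a).
Proof.
have := majorized_monomial a [ffun=> 0%N] r_gt0.
rewrite /weight monomial0 mulr1; apply: majorized_ext => v _.
by rewrite monomial0 mulr1.
Qed.

Lemma majorizedZ r a M g : 0 < r ->
  majorized r M g -> majorized r (`|a| * M) (fun v => a * g v).
Proof. by move=> r0; apply: majorizedM => //; exact: majorized_cst. Qed.

Lemma majorized_big (J : eqType) (s : seq J) (g : J -> V -> R) (N : J -> R) r :
  0 < r -> (forall j, j \in s -> majorized r (N j) (g j)) ->
  majorized r (\sum_(j <- s) N j) (fun v => \sum_(j <- s) g j v).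
Proof.
move=> r0; elim: s => [_|j s IH H].
  rewrite big_nil; have := majorized_cst 0 r0; rewrite normr0.
  apply: majorized_ext => v _; by rewrite big_nil.
rewrite big_cons.
apply: (@majorized_ext _ _ (fun v => g j v + \sum_(j <- s) g j v)).
  by move=> v _; rewrite big_cons.
apply: majorizedD => //; first by apply: H; rewrite mem_head.
by apply: IH => i si; apply: H; rewrite in_cons si orbT.
Qed.

Lemma majorizedX r M g n : 0 < r ->
  majorized r M g -> majorized r (M ^+ n) (fun v => g v ^+ n).
Proof.
move=> r0 gM; elim: n => [|n IH].
  by rewrite expr0; have := majorized_cst 1 r0; rewrite normr1.
by rewrite exprS; apply: majorized_ext (majorizedM r0 gM IH) => v _; rewrite exprS.
Qed.

Lemma majorized_coord r (i : 'I_d) : 0 < r -> majorized r r (fun v => v ord0 i).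
Proof.
move=> r0; pose m : mindex := [ffun j => (j == i : nat)].
have mE v : monomial m v = v ord0 i.
  rewrite /monomial (bigD1 i)//= ffunE eqxx expr1 big1 ?mulr1// => j /negbTE ji.
  by rewrite ffunE ji expr0.
have := majorized_monomial 1 m r0.
rewrite normr1 mul1r /weight mE mxE; apply: majorized_ext => v _.
by rewrite mul1r mE.
Qed.

Lemma majorized_series (g : nat -> V -> R) (N : nat -> R) r M h : 0 < r ->
  (forall n, majorized r (N n) (g n)) -> (forall n, series N n <= M) ->
  (forall v, polydisc r v -> series (g^~ v) @ \oo --> h v) -> majorized r M h.
Proof.
move=> r0 gN NM gh; have N0 n : 0 <= N n by exact: majorized_ge0 (gN n).
have sN := sums_le_nat N0 NM.
apply: (majorized_sum r0 gN sN) => v rv.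
apply: (@has_sum_nat _ _ M); last exact: gh.
move=> A; apply: le_trans (sN A); apply: ler_sum => n _.
exact: majorized_norm_le (gN n) rv.
Qed.

Lemma majorized_expR r M g : 0 < r ->
  majorized r M g -> majorized r (expR M) (fun v => expR (g v)).
Proof.
move=> r0 gM; have M0 := majorized_ge0 gM.
apply: (majorized_series (g := fun n v => exp_coeff (g v) n) (N := exp_coeff M) r0).
- move=> n; have := majorizedZ n`!%:R^-1 r0 (majorizedX n r0 gM).
  rewrite ger0_norm ?invr_ge0// mulrC; apply: majorized_ext => v _.
  by rewrite /exp_coeff/= mulrC.
- move=> n; apply: nondecreasing_cvgn_le; last exact: is_cvg_series_exp_coeff.
  apply/nondecreasing_seqP => k; rewrite /series/= big_nat_recr//= lerDl.
  exact: exp_coeff_ge0.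
- by move=> v _; exact: is_cvg_series_exp_coeff.
Qed.

Lemma majorized_ln1D r M g : 0 < r -> M <= 2^-1 ->
  majorized r M g -> majorized r 1 (fun v => ln (1 + g v)).
Proof.
move=> r0 M2 gM; have M0 := majorized_ge0 gM.
apply: (majorized_series (g := fun n v => mercator (g v) n)
  (N := geometric 2^-1 2^-1) r0).
- move=> n /=; apply: (@majorized_le _ (`|(-1) ^+ n / n.+1%:R| * M ^+ n.+1)).
    rewrite normrM normrX normrN1 expr1n mul1r -exprS.
    apply: le_trans (_ : M ^+ n.+1 <= _); last by rewrite lerXn2r// nnegrE ?invr_ge0.
    rewrite ler_piMl ?exprn_ge0// ger0_norm ?invr_ge0// invf_le1//.
    by rewrite ler1n.
  apply: majorized_ext (majorizedZ _ r0 (majorizedX n.+1 r0 gM)) => v _.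
  by rewrite /mercator mulrAC.
- move=> n; have h : `|2^-1 : R| < 1 by rewrite ger0_norm ?invr_ge0//; lra.
  have := @geometric_le_lim _ n 2^-1 (2^-1 : R).
  by rewrite (_ : 2^-1 / (1 - 2^-1) = 1 :> R) ?invr_ge0 ?invr_gt0//; [apply|field].
- move=> v rv; apply: cvg_mercator; apply: le_trans M2.
  exact: majorized_norm_le gM rv.
Qed.

Lemma majorized_polydisc0 r : 0 <= r -> polydisc r (0 : V).
Proof. by move=> r0 i; rewrite mxE normr0. Qed.

(** The non-constant monomials shrink at least linearly with the radius. *)
Lemma majorized_small r M g e : 0 < r -> 0 < e -> majorized r M g ->
  exists q, [/\ 0 < q, q <= r & majorized q e (fun v => g v - g 0)].
Proof.
move=> r0 e0 gM; have M0 := majorized_ge0 gM; case: gM => c [cM cg].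
pose t := Num.min 1 (e / (M + 1)).
have M10 : 0 < M + 1 by lra.
have t0 : 0 < t by rewrite lt_min ltr01 divr_gt0.
have t1 : t <= 1 by rewrite ge_min lexx.
have tM : t * M <= e.
  apply: (@le_trans _ _ (e / (M + 1) * M)); first by rewrite ler_wpM2r// ge_min lexx orbT.
  by rewrite mulrAC ler_pdivrMr// ler_wpM2l// ?ltW//; lra.
pose z : mindex := [ffun=> 0%N].
have mono0 k : k != z -> exists i, k i != 0%N.
  move=> kz; apply/existsP; apply: contraR kz; rewrite negb_exists => /forallP k0.
  by apply/eqP/ffunP => i; rewrite ffunE; apply/eqP; have := k0 i; rewrite negbK.
have g0 : g 0 = c z.
  apply: (has_sum_uniq (cg 0 (majorized_polydisc0 (ltW r0)))).
  have := has_sum_single z (c z); congr (has_sum _ _); apply/funext => k.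
  have [->|/mono0[i ki]] := eqVneq k z; first by rewrite monomial0 mulr1.
  by rewrite /monomial (bigD1 i)//= mxE expr0n (negbTE ki) mul0r mulr0.
have wt k : k != z -> weight (t * r) k <= t * weight r k.
  move=> /mono0[i ki]; rewrite /weight /monomial (bigD1 i)//= [in leRHS](bigD1 i)//= !mxE exprMn.
  have tn0 : 0 <= t := ltW t0; have rn0 : 0 <= r := ltW r0.
  rewrite mulrA; apply: ler_pM; first by rewrite mulr_ge0 ?exprn_ge0.
  - by apply: prodr_ge0 => j _; rewrite mxE exprn_ge0 ?mulr_ge0.
  - rewrite ler_wpM2r ?exprn_ge0//; case: (k i) ki => // n _.
    by rewrite exprS ger_pMr// exprn_ile1.
  apply: ler_prod => j _; rewrite !mxE exprn_ge0 ?mulr_ge0//=.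
  by rewrite lerXn2r ?nnegrE ?mulr_ge0// ger_pMl.
exists (t * r); split; [exact: mulr_gt0|by rewrite ger_pMl|].
exists (fun k => if k == z then 0 else c k); split=> [A|v tv].
  apply: le_trans tM; apply: le_trans (ler_wpM2l (ltW t0) (cM A)).
  rewrite mulr_sumr; apply: ler_sum => k _; case: eqP => [->|/eqP kz].
    by rewrite normr0 mul0r !mulr_ge0// ltW// weight_gt0.
  by rewrite mulrCA ler_wpM2l// wt.
have rv : polydisc r v by move=> i; apply: le_trans (tv i) _; rewrite ger_pMl.
have := has_sumD (cg v rv) (has_sumN (has_sum_single z (c z))).
rewrite g0; congr (has_sum _ _); apply/funext => k.
by case: eqP => [->|_]; rewrite ?monomial0 ?mulr1 ?subrr ?mul0r// subr0.
Qed.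

End majorized.
Arguments majorized_cst {R d r} a r_gt0.

(** * Affine minorants of a convex function *)

Section convex_minorants.
Variables (R : realType) (d : nat).
Local Notation V := 'rV[R]_d.
Implicit Types (x y v : V) (U : set V) (f : V -> R).

Definition convex_on U f := forall (t : R) x y, 0 <= t -> t <= 1 -> U x -> U y ->
  f (t *: x + (1 - t) *: y) <= t * f x + (1 - t) * f y.

Lemma convex_functionP U f : convex_function U f <-> convex_on U f.
Proof.
split=> [cf t x y t0 t1 Ux Uy|cf t x y].
  by have := @cf (Itv01 t0 t1) x y; rewrite !inE; apply.
by rewrite !inE => Ux Uy; exact: cf.
Qed.

Lemma convex_setP U : convex_set U ->
  forall (t : R) x y, 0 <= t -> t <= 1 -> U x -> U y -> U (t *: x + (1 - t) *: y).
Proof.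
move=> cU t x y t0 t1 Ux Uy.
by have := @cU x y (Itv01 t0 t1); rewrite !inE; apply.
Qed.

Lemma nbhs_polydisc x (P : set V) :
  nbhs x P <-> exists2 r : R, 0 < r & forall v, polydisc r v -> P (x + v).
Proof.
split=> [/nbhs_ballP[r /= r0 rP]|[r r0 rP]].
  exists (r / 2); first exact: divr_gt0.
  move=> v rv; apply: rP; split=> // i j; rewrite /ball/= !mxE opprD addrA subrr sub0r.
  by rewrite normrN ord1 (le_lt_trans (rv j))//; lra.
apply/nbhs_ballP; exists r => //= y [_ xy].
rewrite -(subrKC x y); apply: rP => i; have := xy ord0 i.
by rewrite /ball/= !mxE distrC => /ltW.
Qed.

Definition dot (l v : V) : R := \sum_(i < d) l ord0 i * v ord0 i.

Lemma dotDr l x y : dot l (x + y) = dot l x + dot l y.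
Proof. by rewrite /dot -big_split/=; apply: eq_bigr => i _; rewrite mxE mulrDr. Qed.

Lemma dotZr l t x : dot l (t *: x) = t * dot l x.
Proof. by rewrite /dot mulr_sumr; apply: eq_bigr => i _; rewrite mxE mulrCA. Qed.

Definition l1norm (l : V) : R := \sum_(i < d) `|l ord0 i|.

Lemma l1norm_ge0 l : 0 <= l1norm l. Proof. exact: sumr_ge0. Qed.

Lemma dot_norm_le r l v : polydisc r v -> `|dot l v| <= l1norm l * r.
Proof.
move=> rv; rewrite (le_trans (ler_norm_sum _ _ _))// mulr_suml.
by apply: ler_sum => i _; rewrite normrM ler_wpM2l.
Qed.

Section upper_semicontinuity.
Variables (U : set V) (f : V -> R).
Hypotheses (openU : open U) (cf : convex_on U f).

Lemma convex_usc_segment x w e : U x -> U (x + w) -> 0 < e ->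
  exists2 s, 0 < s & forall t, 0 <= t -> t <= s -> f (x + t *: w) <= f x + e.
Proof.
move=> Ux Uxw e0; pose C := `|f (x + w) - f x| + 1.
have C0 : 0 < C by rewrite ltr_wpDl.
exists (Num.min 1 (e / C)) => [|t t0]; first by rewrite lt_min ltr01 divr_gt0.
rewrite le_min => /andP[t1 te].
have -> : x + t *: w = t *: (x + w) + (1 - t) *: x.
  by apply/rowP => i; rewrite !mxE; ring.
apply: le_trans (cf t0 t1 Uxw Ux) _.
have : t * (f (x + w) - f x) <= e; last by lra.
apply: (@le_trans _ _ (t * C)); last by rewrite -ler_pdivlMr.
by rewrite ler_wpM2l// (le_trans (ler_norm _))// lerDl.
Qed.

(** A step in [k.+1] coordinates is the midpoint of a step in the first [k] and
    a step in the last one, so the estimate propagates one coordinate at a time. *)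
Lemma convex_usc x e : U x -> 0 < e -> exists r, [/\ 0 < r,
  forall v, polydisc r v -> U (x + v) &
  forall v, polydisc r v -> f (x + v) <= f x + e].
Proof.
move=> Ux e0; have /nbhs_polydisc[r0 r00 r0U] := open_nbhs_nbhs (conj openU Ux).
suff H k : (k <= d)%N -> exists2 r, 0 < r & forall v, polydisc r v ->
    (forall i : 'I_d, (k <= i)%N -> v ord0 i = 0) -> f (x + v) <= f x + e.
  have [r rP rf] := H d (leqnn d).
  exists (Num.min r0 r); split; first by rewrite lt_min r00.
    by move=> v rv; apply: r0U => i; apply: le_trans (rv i) _; rewrite ge_min lexx.
  move=> v rv; apply: rf => [i|i]; last by rewrite leqNgt ltn_ord.
  by apply: le_trans (rv i) _; rewrite ge_min lexx orbT.
elim: k => [|k IH] kd.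
  exists 1 => // v _ v0; rewrite (_ : v = 0) ?addr0 ?lerDl ?ltW//.
  by apply/rowP => i; rewrite v0 ?mxE.
have [r rP rf] := IH (ltnW kd); pose i0 := Ordinal kd.
pose w : V := r0 *: delta_mx 0 i0.
have r0w (s : R) : `|s| <= 1 -> polydisc r0 (s *: w).
  move=> s1 i; rewrite !mxE eqxx/= !normrM (gtr0_norm r00) mulrCA ger_pMr//.
  by rewrite mulr_ile1//; case: eqP => _; rewrite ?normr1 ?normr0.
have line : exists2 r', 0 < r' & forall s : R, `|s| <= r' ->
    f (x + s *: delta_mx 0 i0) <= f x + e.
  have Uw1 : U (x + w) by rewrite -(scale1r w); apply/r0U/r0w; rewrite normr1.
  have Uw2 : U (x - w) by rewrite -scaleN1r; apply/r0U/r0w; rewrite normrN1.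
  have [s1 s10 H1] := convex_usc_segment Ux Uw1 e0.
  have [s2 s20 H2] := convex_usc_segment Ux Uw2 e0.
  exists (r0 * Num.min s1 s2); first by rewrite mulr_gt0// lt_min s10.
  move=> s; rewrite -ler_pdivrMl// le_min => /andP[ss1 ss2].
  have [s0|s0] := leP 0 s.
    rewrite (ger0_norm s0) in ss1.
    have := H1 (r0^-1 * s); rewrite scalerA mulrAC mulVf ?gt_eqF// mul1r; apply=> //.
    by rewrite mulr_ge0// invr_ge0 ltW.
  rewrite (ltr0_norm s0) in ss2.
  have := H2 (r0^-1 * - s).
  rewrite scalerN -scaleNr scalerA -mulrN opprK mulrAC mulVf ?gt_eqF// mul1r; apply=> //.
  by rewrite mulr_ge0// ?invr_ge0 ?oppr_ge0 ltW.
have [r' r'0 r'f] := line.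
pose q := Num.min r0 (Num.min r r') / 2.
have q2 : q * 2 = Num.min r0 (Num.min r r') by rewrite divfK.
exists q; first by rewrite divr_gt0// !lt_min r00 rP.
move=> v qv v0; pose v' := v - v ord0 i0 *: delta_mx 0 i0.
have v'E i : v' ord0 i = if i == i0 then 0 else v ord0 i.
  rewrite !mxE eqxx/=; case: eqP => [->|_]; first by rewrite mulr1 subrr.
  by rewrite mulr0 subr0.
have qv2 i : `|2 * v ord0 i| <= Num.min r0 (Num.min r r').
  by rewrite -q2 normrM mulrC normr_nat ler_wpM2r.
have -> : x + v = 2^-1 *: (x + 2 *: v') + (1 - 2^-1) *: (x + (2 * v ord0 i0) *: delta_mx 0 i0).
  by apply/rowP => i; rewrite /v' !mxE; field.
have Uv' : polydisc r0 (2 *: v') /\ polydisc r (2 *: v').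
  split=> i; rewrite mxE v'E; have := qv2 i; rewrite !le_min => /and3P[h1 h2 h3].
    by case: eqP => // _; rewrite mulr0 normr0 ltW.
  by case: eqP => // _; rewrite mulr0 normr0 ltW.
have := qv2 i0; rewrite !le_min => /and3P[h1 h2 h3].
have Uw : U (x + (2 * v ord0 i0) *: delta_mx 0 i0).
  apply: r0U => i; rewrite !mxE eqxx/=.
  by case: eqP => _; rewrite ?mulr1// mulr0 normr0 ltW.
apply: le_trans (cf _ _ (r0U _ Uv'.1) Uw) _; rewrite ?invr_ge0//; first by lra.
have := rf _ Uv'.2; have := r'f _ h3.
have Hv' : forall i : 'I_d, (k <= i)%N -> (2 *: v') ord0 i = 0.
  move=> i ki; rewrite mxE v'E; case: eqP => [|/eqP ii0]; first by rewrite mulr0.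
  rewrite v0 ?mulr0// ltn_neqAle ki andbT; apply: contra ii0 => /eqP ki'.
  by apply/eqP/val_inj.
by move=> ? /(_ Hv'); lra.
Qed.

End upper_semicontinuity.

(** Hahn-Banach one coordinate at a time: convexity makes every lower bound for
    the new slope at most every upper bound. *)
Lemma subgradient U f x : open U -> convex_set U -> convex_on U f -> U x ->
  exists l, forall y, U y -> f x + dot l (y - x) <= f y.
Proof.
move=> openU /convex_setP cU cf Ux.
have /nbhs_polydisc[r0 r00 r0U] := open_nbhs_nbhs (conj openU Ux).
suff H k : (k <= d)%N -> exists l, forall v,
    (forall i : 'I_d, (k <= i)%N -> v ord0 i = 0) ->
    U (x + v) -> f x + dot l v <= f (x + v).
  have [l lP] := H d (leqnn d).
  exists l => y Uy; rewrite -{2}(subrKC x y); apply: lP; rewrite ?subrKC//.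
  by move=> i; rewrite leqNgt ltn_ord.
elim: k => [|k IH] kd.
  exists 0 => v v0 _; have -> : v = 0 by apply/rowP => i; rewrite v0 ?mxE.
  by rewrite /dot big1 ?addr0// => i _; rewrite mxE mul0r.
have [l lP] := IH (ltnW kd); pose i0 := Ordinal kd.
pose e : V := delta_mx 0 i0.
pose Vk v := forall i : 'I_d, (k <= i)%N -> v ord0 i = 0.
pose L := [set c | exists v s, [/\ Vk v, 0 < s, U (x + v - s *: e) &
  c = (f x + dot l v - f (x + v - s *: e)) / s]].
have LP v s : Vk v -> 0 < s -> U (x + v + s *: e) ->
    ubound L ((f (x + v + s *: e) - f x - dot l v) / s).
  move=> v0 s0 Uv _ [v1 [s1 [v10 s10 Uv1 ->]]].
  have ss : 0 < s1 + s by rewrite addr_gt0.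
  pose t := s / (s1 + s).
  have t0 : 0 <= t by rewrite divr_ge0 ?ltW.
  have t1 : t <= 1 by rewrite ler_pdivrMr// mul1r lerDr ltW.
  have t1E : 1 - t = s1 / (s1 + s) by rewrite /t; field; rewrite gt_eqF.
  have E : t *: (x + v1 - s1 *: e) + (1 - t) *: (x + v + s *: e) =
      x + (t *: v1 + (1 - t) *: v).
    apply/rowP => i; rewrite !mxE t1E /t; field; by rewrite gt_eqF.
  have Vt : Vk (t *: v1 + (1 - t) *: v).
    by move=> i ki; rewrite !mxE v10// v0// !mulr0 addr0.
  have := lP _ Vt; rewrite -E => /(_ (cU _ _ _ t0 t1 Uv1 Uv)).
  move=> /le_trans /(_ (cf _ _ _ t0 t1 Uv1 Uv)).
  rewrite dotDr !dotZr t1E /t.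
  set a := f (_ - _); set b := f (_ + _ *: _) => H.
  rewrite ler_pdivrMr// mulrAC ler_pdivlMr//.
  have {H} := ler_wpM2r (ltW ss) H.
  rewrite [leLHS](_ : _ = f x * (s1 + s) + s * dot l v1 + s1 * dot l v).
    rewrite [leRHS](_ : _ = s * a + s1 * b); first by lra.
    by field; rewrite gt_eqF.
  by field; rewrite gt_eqF.
have Vk0 : Vk 0 by move=> i _; rewrite mxE.
have r0e (s : R) : `|s| <= r0 -> polydisc r0 (s *: e).
  move=> sr i; rewrite !mxE eqxx/= normrM.
  by case: eqP => _; rewrite ?normr1 ?mulr1// normr0 mulr0 ltW.
have hL : has_sup L.
  split.
    exists ((f x + dot l 0 - f (x + 0 - r0 *: e)) / r0); exists 0, r0; split => //.
    by rewrite addr0 -scaleNr; apply/r0U/r0e; rewrite normrN gtr0_norm.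
  exists ((f (x + 0 + r0 *: e) - f x - dot l 0) / r0); apply: LP => //.
  by rewrite addr0; apply/r0U/r0e; rewrite gtr0_norm.
pose c := sup L.
exists (l + (c - l ord0 i0) *: e) => v v0 Uv.
pose s := v ord0 i0; pose v' := v - s *: e.
have vE : v = v' + s *: e by rewrite subrK.
have xvE : x + v' + s *: e = x + v by rewrite -addrA -vE.
have Vv' : Vk v'.
  move=> i ki; rewrite !mxE eqxx/= /s.
  have [->|ii0] := eqVneq i i0; first by rewrite mulr1 subrr.
  rewrite mulr0 subr0 v0// ltn_neqAle ki andbT; apply: contra ii0 => /eqP ki'.
  by apply/eqP/val_inj.
have -> : dot (l + (c - l ord0 i0) *: e) v = dot l v' + s * c.
  have -> : dot l v' = dot l v - s * l ord0 i0.
    rewrite /v' dotDr -scaleNr dotZr; congr (_ + _); rewrite mulNr; congr (- (_ * _)).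
    rewrite /dot (bigD1 i0)//= mxE !eqxx mulr1 big1 ?addr0// => i /negbTE ii0.
    by rewrite mxE ii0 andbF mulr0.
  rewrite /dot (eq_bigr (fun i => l ord0 i * v ord0 i +
      (c - l ord0 i0) * (e ord0 i * v ord0 i))).
    rewrite big_split/= -mulr_sumr [X in _ * X](bigD1 i0)//= mxE !eqxx mul1r.
    rewrite [X in _ + _ * (_ + X)]big1.
      by rewrite addr0 -/s; ring.
    by move=> i /negbTE ii0; rewrite mxE ii0 andbF mul0r.
  by move=> i _; rewrite !mxE; ring.
have [s0|s0|s0] := ltgtP s 0.
- have : L ((f x + dot l v' - f (x + v' - (- s) *: e)) / - s).
    exists v', (- s); split; rewrite ?oppr_gt0//.
    by rewrite scaleNr opprK xvE.
  move=> /(sup_ubound hL.2); rewrite -/c scaleNr opprK xvE.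
  by rewrite ler_pdivrMr ?oppr_gt0//; lra.
- have := LP v' s Vv' s0; rewrite xvE => /(_ Uv) /(ge_sup hL.1).
  by rewrite -/c ler_pdivlMr//; lra.
- have -> : v = v' by rewrite vE s0 scale0r addr0.
  rewrite s0 mul0r addr0; apply: lP => //.
  by move: Uv; rewrite vE s0 scale0r addr0.
Qed.

Definition affine (a : V * R) x : R := dot a.1 x + a.2.

Lemma compact_exhaustion U : open U -> exists K : nat -> set V,
  [/\ forall n, compact (K n), forall n, K n `<=` U & U `<=` \bigcup_n K n].
Proof.
have dist_cont (y : V) : continuous (fun x : V => `|x - y|).
  move=> x; apply: (cvg_comp (fun x : V => x - y) (@Num.norm _ _)).
    by apply: (@cvgB _ _ _ (nbhs x)); [exact: cvg_id|exact: cvg_cst].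
  exact: norm_continuous.
move=> openU; pose K n := [set x : V | `|x| <= n%:R] `&`
  \bigcap_(y in ~` U) [set x : V | n.+1%:R^-1 <= `|x - y|].
exists K; split=> [n|n x [_ Kx]|x Ux].
- apply: bounded_closed_compact.
    exists n%:R; split=> // M nM x [/= xn _]; exact: le_trans xn (ltW nM).
  apply: closedI.
    apply: (@preimage_closed _ _ _ [set z : R | z <= n%:R]); last exact: closed_le.
    by move=> x _; exact: norm_continuous.
  apply: closed_bigI => y _.
  apply: (@preimage_closed _ _ (fun x : V => `|x - y|) [set z : R | n.+1%:R^-1 <= z]).
    by move=> x _; exact: dist_cont.
  exact: closed_ge.
- apply: contrapT => nUx; have /= := Kx _ nUx.
  by rewrite subrr normr0 leNgt invr_gt0 ltr0n.
have /nbhs_ballP[r /= r0 rU] := open_nbhs_nbhs (conj openU Ux).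
exists (maxn (Num.trunc `|x|).+1 (Num.trunc r^-1)) => //; split=> /=.
  apply: le_trans (ltW (truncnS_gt `|x|)) _.
  by rewrite ler_nat leq_maxl.
move=> y nUy /=; rewrite leNgt; apply/negP => xy; apply: nUy; apply: rU.
rewrite mx_norm_ball /ball_/=; apply: lt_le_trans xy _.
rewrite invf_ple ?posrE//; apply: ltW; apply: lt_le_trans (truncnS_gt _) _.
by rewrite ler_nat ltnS leq_maxr.
Qed.

(** Near [y] the tangent at [y] falls short of [f] by less than [e n], because [f] is
    upper semicontinuous; finitely many such neighborhoods cover the [n]-th compact
    set of an exhaustion. *)
Lemma affine_minorants U f (e : nat -> R) :
  open U -> convex_set U -> convex_on U f -> (forall n, 0 < e n) ->
  exists s : nat -> seq (V * R),
    (forall n a, a \in s n -> forall y, U y -> affine a y <= f y) /\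
    (forall x, U x -> exists n a, a \in s n /\ f x - affine a x < e n).
Proof.
move=> openU cU cf e0.
have [K [cK KU UK]] := compact_exhaustion openU.
have /choice[a aP] y : exists a, U y ->
    (forall x, U x -> affine a x <= f x) /\ affine a y = f y.
  have [Uy|nUy] := pselect (U y); last by exists (0, 0).
  have [l lP] := subgradient openU cU cf Uy.
  have lE x : affine (l, f y - dot l y) x = f y + dot l (x - y).
    rewrite /affine/= (_ : dot l x = dot l (x - y) + dot l y); first by ring.
    by rewrite -dotDr subrK.
  exists (l, f y - dot l y) => _; split=> [x Ux|]; first by rewrite lE lP.
  by rewrite lE subrr -(scale0r 0) dotZr mul0r addr0.
have fin n : exists D : seq V, (forall y, y \in D -> U y) /\
    forall x, K n x -> exists2 y, y \in D & f x - affine (a y) x < e n.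
  have := cK n; rewrite compact_cover.
  move=> /(_ _ U (fun y => interior [set x | f x - affine (a y) x < e n])).
  case=> [y _|x Kx|D DU KD]; first exact: open_interior.
    have Ux := KU _ _ Kx; exists x => //; apply/nbhs_polydisc.
    have [al ax] := aP x Ux.
    have e30 : 0 < e n / 3 by have := e0 n; lra.
    have [r [r0 rU rf]] := convex_usc openU cf Ux e30.
    have L0 : 0 < l1norm (a x).1 + 1 by rewrite ltr_wpDl ?l1norm_ge0.
    exists (Num.min r (e n / 3 / (l1norm (a x).1 + 1))); first by rewrite lt_min r0 divr_gt0.
    move=> v rv /=.
    have rv1 : polydisc r v by move=> i; apply: le_trans (rv i) _; rewrite ge_min lexx.
    have rv2 : polydisc (e n / 3 / (l1norm (a x).1 + 1)) v.
      by move=> i; apply: le_trans (rv i) _; rewrite ge_min lexx orbT.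
    have := rf _ rv1; have := dot_norm_le (a x).1 rv2.
    have : l1norm (a x).1 * (e n / 3 / (l1norm (a x).1 + 1)) <= e n / 3.
      rewrite mulrCA ger_pMr// ler_pdivrMr// mul1r; lra.
    move: ax; rewrite /affine dotDr ler_norml => ax ? /andP[? ?] ?; have := e0 n; lra.
  exists D; split=> [y yD|x /KD[y yD /interior_subset]]; last by exists y.
  by have := DU y yD; rewrite inE.
have [D DP] := choice fin.
exists (fun n => [seq a y | y <- D n]); split=> [n _ /mapP[y yD ->]|x /UK[n _ Knx]].
  by case: (aP y ((DP n).1 y yD)).
have [y yD ylt] := (DP n).2 x Knx.
by exists n, (a y); split=> //; exact: map_f.
Qed.

End convex_minorants.

(** * Soft maxima *)

Section softmax.
Variable R : realType.
Implicit Types (l h : R) (t : seq R).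

(** This is [l^-1 * ln (\sum_(b <- h :: t) expR (l * b))]; factoring [h] out leaves the
    increment as [ln (1 + _)], to which the power series of the logarithm applies. *)
Definition softmax l h t : R := h + l^-1 * ln (1 + \sum_(b <- t) expR (l * (b - h))).

(** The exponential form, symmetric in [h] and the entries of [t], is the one that
    monotonicity and convexity are read off from. *)
Lemma softmax_leP l h t (H : R) : 0 < l ->
  (softmax l h t <= H) = (\sum_(b <- h :: t) expR (l * (b - H)) <= 1).
Proof.
move=> l0; rewrite /softmax -lerBrDl ler_pdivrMl//.
have W0 : 0 < 1 + \sum_(b <- t) expR (l * (b - h)).
  by rewrite ltr_pwDl// sumr_ge0// => b _; exact: expR_ge0.
rewrite -[X in ln _ <= X]expRK ler_ln ?posrE ?expR_gt0//.
rewrite -(ler_pM2r (expR_gt0 (l * (h - H)))) -expRD.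
rewrite (_ : l * (H - h) + l * (h - H) = 0); last by ring.
rewrite expR0 mulrDl mul1r mulr_suml big_cons; congr (_ + _ <= _).
by apply: eq_bigr => b _; rewrite -expRD; congr expR; ring.
Qed.

Lemma le_softmax l h t b : 0 < l -> b \in h :: t -> b <= softmax l h t.
Proof.
move=> l0 bt; have := lexx (softmax l h t); rewrite softmax_leP//.
set S := softmax l h t; rewrite (perm_big _ (perm_to_rem bt)) big_cons => H.
have {H} : expR (l * (b - S)) <= 1.
  apply: le_trans H; rewrite lerDl sumr_ge0// => c _; exact: expR_ge0.
by rewrite expR_le1 pmulr_rle0// subr_le0.
Qed.

Lemma softmax_le l h t (T : R) : 0 < l -> (forall b, b \in h :: t -> b <= T) ->
  softmax l h t <= T + (size t)%:R / l.
Proof.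
move=> l0 hT; rewrite softmax_leP//.
apply: (@le_trans _ _ (\sum_(b <- h :: t) expR (- (size t)%:R))).
  rewrite big_seq [leRHS]big_seq; apply: ler_sum => b /hT bT.
  rewrite ler_expR opprD addrA mulrDr mulrN mulrCA divff ?gt_eqF// mulr1.
  by rewrite gerDr pmulr_rle0// subr_le0.
rewrite big_const_seq count_predT iter_addr_0 -[leLHS]mulr_natl expRN ler_pdivrMr ?expR_gt0//.
by rewrite mul1r [size (_ :: _)]/= -natr1 addrC expR_ge1Dx.
Qed.


End softmax.

Section soft_maximum_of_minorants.
Variables (R : realType) (d : nat).
Local Notation V := 'rV[R]_d.
Variables (e : R) (s : nat -> seq (V * R)) (a0 : V * R).
Hypothesis e0 : 0 < e.

Definition gap n : R := e / 2 ^+ n.+1.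

(** This is [(size (s n)).+1 * 4 ^ n.+1 / e]: the overshoot [size (s n) / rate n] stays
    below half of [gap n], and [rate n * D] is at least [2 * (size (s n)).+1] as soon
    as [gap n <= D]. *)
Definition rate n : R := (size (s n)).+1%:R * (e / gap n ^+ 2).

(** The offset [e - gap m] grows with the stage, so that the minorants of late
    stages end up below the values reached at an earlier one. *)
Fixpoint soft_partial n : V -> R := fun x =>
  if n is m.+1 then
    softmax (rate m) (soft_partial m x) [seq affine a x - (e - gap m) | a <- s m]
  else affine a0 x - (e - gap 0).

Lemma gap_gt0 n : 0 < gap n. Proof. by rewrite divr_gt0 ?exprn_gt0. Qed.

Lemma gapS n : gap n.+1 = gap n / 2.
Proof. by rewrite /gap exprS; field; rewrite expf_neq0. Qed.

Lemma gap0 : gap 0 = e / 2. Proof. by rewrite /gap expr1. Qed.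

Lemma gap_le m n : (m <= n)%N -> gap n <= gap m.
Proof.
move=> /subnK <-; elim: (n - m)%N => [//|k IH]; rewrite addSn gapS.
by apply: le_trans IH; have := gap_gt0 (k + m); lra.
Qed.

Lemma gap_half n : gap n * 2 <= e.
Proof. by have := gap_le (leq0n n); rewrite gap0; lra. Qed.

Lemma rate_gt0 n : 0 < rate n.
Proof. by rewrite mulr_gt0// divr_gt0// exprn_gt0// gap_gt0. Qed.

Lemma size_rate_le n : (size (s n)).+1%:R / rate n <= gap n / 2.
Proof.
rewrite /rate invfM mulrA divff ?pnatr_eq0// mul1r invf_div ler_pdivrMr//.
have := ler_wpM2l (ltW (gap_gt0 n)) (gap_half n); lra.
Qed.

Lemma affine_conv (a : V * R) (p : R) (x y : V) :
  affine a (p *: x + (1 - p) *: y) = p * affine a x + (1 - p) * affine a y.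
Proof. by rewrite /affine dotDr !dotZr; ring. Qed.

(** With [S] the new stage, [SP] says that the terms [expR (l * (b - S))] over the
    entries [b] sum to at most 1 at [x] and at [y]; convexity of [expR] carries this
    to the intermediate point. *)
Lemma soft_partial_convex n : convex_on setT (soft_partial n).
Proof.
move=> p x y p0 p1 _ _; elim: n => [|n IH] /=.
  by rewrite affine_conv le_eqVlt; apply/orP; left; apply/eqP; ring.
set z := _ + _; set l := rate n; have l0 : 0 < l := rate_gt0 n.
set S := fun w => softmax l (soft_partial n w) [seq affine a w - (e - gap n) | a <- s n].
rewrite -/(S x) -/(S y) softmax_leP// big_cons big_map.
have SP w : expR (l * (soft_partial n w - S w)) +
    \sum_(a <- s n) expR (l * (affine a w - (e - gap n) - S w)) <= 1.
  by have := lexx (S w); rewrite {1}/S softmax_leP// big_cons big_map.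
have conv (u v w : R) : w <= p * u + (1 - p) * v ->
    expR (l * (w - (p * S x + (1 - p) * S y))) <=
    p * expR (l * (u - S x)) + (1 - p) * expR (l * (v - S y)).
  move=> wuv; have : expR (p * (l * (u - S x)) + (1 - p) * (l * (v - S y))) <=
      p * expR (l * (u - S x)) + (1 - p) * expR (l * (v - S y)).
    exact: (convex_expR (Itv01 p0 p1)).
  apply: le_trans; rewrite ler_expR.
  have := ler_wpM2l (ltW l0) wuv; lra.
apply: le_trans (lerD (conv _ _ _ IH) (ler_sum _ (fun a _ => conv
  (affine a x - (e - gap n)) (affine a y - (e - gap n)) _ _))) _.
  by move=> a _; rewrite affine_conv; lra.
rewrite big_split/= -!mulr_sumr addrACA -!mulrDr.
have := ler_wpM2l p0 (SP x); have p1' : 0 <= 1 - p by lra.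
by have := ler_wpM2l p1' (SP y); lra.
Qed.

Lemma soft_partial_nondecreasing x : nondecreasing_seq (soft_partial ^~ x).
Proof.
apply/nondecreasing_seqP => n /=; apply: le_softmax; first exact: rate_gt0.
exact: mem_head.
Qed.

Lemma soft_partial_ge n a x : a \in s n -> affine a x - (e - gap n) <= soft_partial n.+1 x.
Proof.
move=> an /=; apply: le_softmax; first exact: rate_gt0.
by rewrite in_cons (map_f (fun a => affine a x - (e - gap n)))// orbT.
Qed.

Lemma majorized_dot r (l : V) : 0 < r -> majorized r (l1norm l * r) (dot l).
Proof.
move=> r0; rewrite /l1norm mulr_suml.
by apply: majorized_big => // i _; apply: majorizedZ => //; exact: majorized_coord.
Qed.

(** Write [g = g 0 * (1 + u)] and shrink the radius until [u] has norm 1/2. *)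
Lemma majorized_ln r M (g : V -> R) : 0 < r -> majorized r M g -> 0 < g 0 ->
  exists q N, [/\ 0 < q, q <= r & majorized q N (fun v => ln (g v))].
Proof.
move=> r0 gM g0.
have [q [q0 qr gq]] := majorized_small r0 (divr_gt0 g0 (ltr0n _ 2)) gM.
exists q, (`|ln (g 0)| + 1); split=> //.
have half : `|(g 0)^-1| * (g 0 / 2) = 2^-1.
  by rewrite gtr0_norm ?invr_gt0// mulrA mulVf ?mul1r// gt_eqF.
have uq := majorizedZ (g 0)^-1 q0 gq; rewrite half in uq.
have := majorizedD q0 (majorized_cst (ln (g 0)) q0) (majorized_ln1D q0 (lexx _) uq).
apply: majorized_ext => v qv.
have := majorized_norm_le uq qv; rewrite ler_norml => /andP[u1 u2].
rewrite -lnM ?posrE//; last by lra.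
by congr ln; field; rewrite gt_eqF.
Qed.

(** The radius obtained here may shrink to 0 as [n] grows, so this serves for one
    fixed stage only. *)
Lemma soft_partial_majorized n x : exists r M, 0 < r /\
  majorized r M (fun v => soft_partial n (x + v)).
Proof.
have aff a r : 0 < r -> majorized r (`|affine a x| + l1norm a.1 * r)
    (fun v => affine a (x + v)).
  move=> r0; have := majorizedD r0 (majorized_cst (affine a x) r0) (majorized_dot a.1 r0).
  by apply: majorized_ext => v _; rewrite /affine dotDr; ring.
elim: n => [|n [r [M [r0 hM]]]] /=.
  exists 1; eexists; split=> //; apply: majorizedD => //; first exact: aff.
  exact: majorized_cst.
set l := rate n.
have wM : exists N, majorized r N (fun v => 1 +
    \sum_(a <- s n) expR (l * (affine a (x + v) - (e - gap n) - soft_partial n (x + v)))).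
  eexists; apply: majorizedD => //; first exact: majorized_cst.
  apply: majorized_big => // a _; apply: majorized_expR => //; apply: majorizedZ => //.
  apply: majorizedD => //; last first.
    by apply: majorized_ext (majorizedZ (-1) r0 hM) => v _; rewrite mulN1r.
  apply: majorizedD => //; [exact: aff|exact: majorized_cst].
have [N wN] := wM.
have [|q [N' [q0 qr qN]]] := majorized_ln r0 wN.
  by rewrite ltr_pwDl// sumr_ge0// => a _; exact: expR_ge0.
exists q, (M + `|l^-1| * N'); split=> //.
apply: (@majorized_ext _ _ _ _ (fun v => soft_partial n (x + v) + l^-1 *
    ln (1 + \sum_(a <- s n) expR (l * (affine a (x + v) - (e - gap n) - soft_partial n (x + v)))))).
  by move=> v _; rewrite /softmax big_map.
apply: majorizedD => //; first exact: majorized_shrink (ltW q0) qr hM.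
exact: (majorizedZ _ q0 qN).
Qed.

Section limit.
Variables (U : set V) (f : V -> R).
Hypothesis minorant : forall n a, a \in s n -> forall y, U y -> affine a y <= f y.
Hypothesis minorant0 : forall y, U y -> affine a0 y <= f y.

(** The overshoot of the step costs at most half of [gap n], and [gap n / 2] is [gap n.+1]. *)
Lemma soft_partial_le n x : U x -> soft_partial n x <= f x - gap n.
Proof.
move=> Ux; elim: n => [|n IH].
  by rewrite /= gap0; have := minorant0 Ux; lra.
apply: le_trans (softmax_le (T := f x - gap n) (rate_gt0 n) _) _.
  move=> b; rewrite in_cons => /orP[/eqP -> //|/mapP[a an ->]].
  by have := minorant an Ux; have := gap_half n; lra.
rewrite size_map; have := size_rate_le n; rewrite -natr1 mulrDl mul1r gapS.
by have := rate_gt0 n; rewrite -invr_gt0; lra.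
Qed.

Lemma soft_partial_cvg x : U x -> cvgn (soft_partial ^~ x).
Proof.
move=> Ux; apply: nondecreasing_is_cvgn; first exact: soft_partial_nondecreasing.
exists (f x) => _ [n _ <-]; apply: le_trans (soft_partial_le n Ux) _.
by rewrite gerBl ltW// gap_gt0.
Qed.

(** The margin: in the polydisc a later entry is at most
    [f x + D / 2 - e + gap n], with [gap n <= D], whereas [soft_partial n] stays
    within [D / 2 + gap K <= 3 / 2 * D] of [soft_partial K x >= f x - e + 4 * D].
    Hence every entry lies below it by at least [D], and as
    [rate n * D >= 2 * (size (s n)).+1] the [size (s n)] exponentials, each at most
    [expR (- (rate n * D))], add up to at most 1/2. *)
Lemma majorized_increment r D x K n : 0 < r -> 0 < D -> (K <= n)%N -> gap K <= D ->
  (forall v, polydisc r v -> U (x + v) /\ f (x + v) <= f x + D / 2) ->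
  f x - e + 4 * D <= soft_partial K x ->
  majorized r (D / 2 + gap K - gap n) (fun v => soft_partial n (x + v) - soft_partial K x) ->
  majorized r (gap n / 2) (fun v => soft_partial n.+1 (x + v) - soft_partial n (x + v)).
Proof.
move=> r0 D0 Kn gK rU low qM; set l := rate n; have l0 : 0 < l := rate_gt0 n.
pose N := size (s n).
have gnD : gap n <= D := le_trans (gap_le Kn) gK.
have lD : 2 * N.+1%:R <= l * D.
  rewrite /l /rate -/N mulrC -mulrA ler_pM2l//.
  rewrite mulrAC ler_pdivlMr ?exprn_gt0 ?gap_gt0// expr2 mulrA [2 * _]mulrC.
  by apply: ler_pM (gap_half n) gnD; rewrite ?mulr_ge0// ltW// gap_gt0.
(* The linear part of [a] is maximal over the polydisc at a corner [v], and there it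
   equals its norm. *)
have corner a : a \in s n -> affine a x + l1norm a.1 * r <= f x + D / 2.
  move=> an; pose v : V := \row_i (r * Num.sg (a.1 ord0 i)).
  have rv : polydisc r v.
    by move=> i; rewrite mxE normrM gtr0_norm// ger_pMr// normr_sg lern1 leq_b1.
  have [Uv fv] := rU v rv; apply: le_trans fv; apply: le_trans (minorant an Uv).
  rewrite /affine dotDr [leRHS]addrAC lerD2l /l1norm mulr_suml.
  by apply: ler_sum => i _; rewrite mxE [leRHS]mulrCA [_ * Num.sg _]mulrC -normrEsg mulrC.
have termM a : a \in s n -> majorized r (expR (- (l * D)))
    (fun v => expR (l * (affine a (x + v) - (e - gap n) - soft_partial n (x + v)))).
  move=> an; pose C := expR (l * (affine a x - (e - gap n) - soft_partial K x)).
  have := majorizedZ C r0 (majorized_expR r0 (majorizedZ l r0 (majorizedD r0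
    (majorized_dot a.1 r0) (majorizedZ (-1) r0 qM)))).
  rewrite normrN1 mul1r (gtr0_norm l0) ger0_norm ?expR_ge0// -expRD => H.
  apply: majorized_ext (majorized_le _ H) => [v _|].
    by rewrite -expRD; congr expR; rewrite /affine dotDr; ring.
  rewrite ler_expR.
  suff : l * (affine a x - (e - gap n) - soft_partial K x +
      (l1norm a.1 * r + (D / 2 + gap K - gap n))) <= l * - D by lra.
  by rewrite ler_pM2l//; have := corner a an; have := gap_gt0 n; lra.
have sumM := majorized_big r0 termM.
have half : \sum_(a <- s n) expR (- (l * D)) <= 2^-1.
  rewrite big_const_seq count_predT iter_addr_0 -[leLHS]mulr_natl expRN.
  rewrite ler_pdivrMr ?expR_gt0//.
  by move: lD (expR_ge1Dx (l * D)); rewrite -(natr1 N) -[size (s n)]/N; lra.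
have := majorizedZ l^-1 r0 (majorized_ln1D r0 half sumM).
rewrite mulr1 gtr0_norm ?invr_gt0// => H.
apply: majorized_ext (majorized_le _ H) => [v _|].
  by rewrite /= /softmax big_map [RHS]addrC addKr.
apply: le_trans (size_rate_le n); rewrite ler_peMl ?ler1n//.
by rewrite invr_ge0 ltW.
Qed.

Hypothesis openU : open U.
Hypothesis convexf : convex_on U f.
Hypothesis cover : forall x, U x -> exists n a, a \in s n /\ f x - affine a x < gap n.

Definition soft_sup x : R := limn (soft_partial ^~ x).

(** From stage [K] on the increments have norms [gap n / 2] on one fixed polydisc, and
    these add up to [gap K]. *)
Lemma soft_sup_majorized x : U x -> exists r M, 0 < r /\
  majorized r M (fun v => soft_sup (x + v)).
Proof.
move=> Ux; have [k [a [ak fa]]] := cover Ux.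
pose D := (soft_partial k.+1 x - (f x - e)) / 4.
have D0 : 0 < D by rewrite divr_gt0// subr_gt0; have := soft_partial_ge x ak; lra.
(* [gap K] is within the margin as soon as [2 ^ j > e / D]. *)
have [j jP] : exists j, gap j <= D.
  exists (Num.trunc (e / D)); rewrite ler_pdivrMr ?exprn_gt0// -ler_pdivrMl// mulrC.
  apply: le_trans (ltW (truncnS_gt _)) _.
  by rewrite -natrX ler_nat ltnW// ltn_expl.
pose K := maxn k.+1 j.
have gK : gap K <= D by apply: le_trans jP; apply: gap_le; exact: leq_maxr.
have low : f x - e + 4 * D <= soft_partial K x.
  apply: (@le_trans _ _ (soft_partial k.+1 x)); first by rewrite /D; lra.
  by apply: soft_partial_nondecreasing; exact: leq_maxl.
have [r1 [M [r10 hM]]] := soft_partial_majorized K x.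
have D20 : 0 < D / 2 by lra.
have [r2 [r20 r21 hD]] := majorized_small r10 D20 hM.
have [r3 [r30 r3U r3f]] := convex_usc openU convexf Ux D20.
pose r := Num.min r2 r3.
have r0 : 0 < r by rewrite lt_min r20.
have r2r : r <= r2 by rewrite ge_min lexx.
have r3r : r <= r3 by rewrite ge_min lexx orbT.
have rU v : polydisc r v -> U (x + v) /\ f (x + v) <= f x + D / 2.
  by move=> rv; split; [apply: r3U|apply: r3f] => i; apply: le_trans (rv i) _.
have step i : majorized r (D / 2 + gap K - gap (i + K))
    (fun v => soft_partial (i + K) (x + v) - soft_partial K x).
  elim: i => [|i IH].
    rewrite add0n addrK; apply: majorized_shrink (ltW r0) r2r _.
    by apply: majorized_ext hD => v _; rewrite addr0.
  have := majorizedD r0 IH (majorized_increment r0 D0 (leq_addl i K) gK rU low IH).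
  move=> H; apply: majorized_ext (majorized_le _ H) => [v _|].
    by rewrite addSn; ring.
  by rewrite addSn gapS; lra.
have sum : majorized r (gap K) (fun v => soft_sup (x + v) - soft_partial K (x + v)).
  apply: (majorized_series
    (g := fun i v => soft_partial (i + K).+1 (x + v) - soft_partial (i + K) (x + v))
    (N := fun i => gap (i + K) / 2) r0).
  - by move=> i; exact: majorized_increment r0 D0 (leq_addl i K) gK rU low (step i).
  - move=> n; apply: (@le_trans _ _ (gap K - gap (n + K))).
      rewrite /series/=; elim: n => [|n IH]; first by rewrite big_geq// subrr.
      by rewrite big_nat_recr//= addSn gapS; lra.
    by rewrite gerBl ltW// gap_gt0.
  - move=> v rv; rewrite (_ : series _ =
        (fun n => soft_partial (n + K) (x + v)) - cst (soft_partial K (x + v))).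
      apply: cvgB; last exact: cvg_cst.
      by rewrite (cvg_shiftn K (soft_partial ^~ (x + v))); exact: soft_partial_cvg (rU v rv).1.
    apply/funext => n; rewrite /series/=.
    by rewrite (telescope_sumr (fun k => soft_partial (k + K) (x + v))).
exists r; eexists; split=> //.
apply: (@majorized_ext _ _ _ _ (fun v => soft_partial K (x + v) +
    (soft_sup (x + v) - soft_partial K (x + v)))); first by move=> v _; ring.
apply: majorizedD => //; last exact: sum.
exact: majorized_shrink (ltW r0) (le_trans r2r r21) hM.
Qed.

End limit.
End soft_maximum_of_minorants.

(** * Approximation by a real-analytic convex function *)

Section approximation.
Variables (R : realType) (d : nat).
Local Notation V := 'rV[R]_d.

Lemma majorized_real_analytic r M (g : V -> R) x : 0 < r ->
  majorized r M (fun v => g (x + v)) -> real_analytic_at g x.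
Proof.
move=> r0 [c [_ cg]]; exists c; apply/nbhs_polydisc; exists r => // v rv.
have FF := @totally_filter {ffun 'I_d -> nat}.
rewrite addrAC subrr add0r; apply/cvgrPdist_le => e e0.
have [A HA] := cg v rv e e0; exists A => // B AB /=.
by rewrite distrC /partial_sum -(big_seq_fsetE _ _ xpredT (fun k => c k * monomial k v)) HA.
Qed.

End approximation.

Theorem theorem1 (R : realType) (d : nat) (U : set 'rV[R]_d)
    (openU : open U) (convexU : convex_set U)
    (f : 'rV[R]_d -> R) (convexf : convex_function U f)
    (e : R) (e_gt0 : 0 < e) :
  exists g : 'rV[R]_d -> R,
    [/\ real_analytic_on U g,
        convex_function U g &
        forall x, U x -> f x - e <= g x /\ g x <= f x].
Proof.
have [[x0 Ux0]|U0] := pselect (exists x, U x); last first.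
  have U00 x : U x -> False by move=> Ux; apply: U0; exists x.
  exists (fun=> 0); split=> [x /U00//|t x y|x /U00//].
  by rewrite inE => /U00.
move/convex_functionP: convexf => cf.
have [s [minor cover]] := affine_minorants openU convexU cf (gap_gt0 e_gt0).
have [n0 [a0 [a0s _]]] := cover _ Ux0.
have minor0 y : U y -> affine a0 y <= f y by exact: minor a0s y.
have cvg := soft_partial_cvg e_gt0 minor minor0.
have ge_partial n x : U x -> soft_partial e s a0 n x <= soft_sup e s a0 x.
  move=> Ux; apply: (nondecreasing_cvgn_le _ (cvg x Ux) n).
  exact: soft_partial_nondecreasing.
exists (soft_sup e s a0); split.
- move=> x Ux.
  have [r [M [r0 gM]]] := soft_sup_majorized e_gt0 minor minor0 openU cf cover Ux.
  exact: majorized_real_analytic r0 gM.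
- apply/convex_functionP => t x y t0 t1 Ux Uy.
  apply: limr_le; first exact: cvg (convex_setP convexU t0 t1 Ux Uy).
  near=> n; apply: le_trans (soft_partial_convex s a0 e_gt0 n t0 t1 I I) _.
  by apply: lerD; rewrite ler_wpM2l ?subr_ge0// ge_partial.
- move=> x Ux; split.
    have [n [a [an fa]]] := cover x Ux.
    by have := soft_partial_ge a0 e_gt0 x an; have := ge_partial n.+1 x Ux; lra.
  apply: limr_le; first exact: cvg.
  near=> n; apply: le_trans (soft_partial_le e_gt0 minor minor0 n Ux) _.
  by rewrite gerBl ltW// gap_gt0.
Unshelve. all: by end_near.
Qed.
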